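(* Let $g$ be a Sonine function. Then $g$ is not bounded on any right neighborhood of $0$: for every $\varepsilon>0$ there is no constant $M$ with $|g(t)|\le M$ for almost every $t \in\, ]0,\varepsilon]$. Consequently, the kernel $g$ of a generalized fractional derivative $\mathrm{D}_g$ cannot be bounded on any right neighborhood of $0$.
   Context: $L^1_{\mathrm{loc}}([0,\infty[)$ denotes the (real-valued) functions integrable over every bounded interval $[0,T]$, and $(f\ast g)(t) = \int_0^t f(s)\,g(t-s)\,ds$. A function $g\in L^1_{\mathrm{loc}}([0,\infty[)$ is called a Sonine function if there is $f\in L^1_{\mathrm{loc}}([0,\infty[)$ such that $(g\ast f)(t)=1$ for almost every $t>0$ (the Sonine equation). For $f,g\in L^1_{\mathrm{loc}}([0,\infty[)$ put $\mathrm{D}_g\,\varphi := \frac{d}{dt}(g\ast\varphi)$ and $\mathrm{I}_f\,\varphi := f\ast\varphi$ ($\frac{d}{dt}$ is the almost-everywhere derivative of a locally absolutely continuous function). The operator $\mathrm{D}_g$ is called a generalized fractional derivative, with associated generalized fractional integral $\mathrm{I}_f$, if $\mathrm{D}_g\,\mathrm{I}_f\,\varphi=\varphi$ for all $\varphi\in L^1_{\mathrm{loc}}([0,\infty[)$ and $\mathrm{I}_f\,\mathrm{D}_g\,\varphi=\varphi$ for all $\varphi \in AC([0,\infty[)$ (functions absolutely continuous on every bounded interval $[0,T]$), with equalities almost everywhere. *)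

(* Defs.v *)
From HB Require Import structures.
From mathcomp Require Import all_boot all_order all_algebra.
From mathcomp Require Import all_classical all_reals all_analysis.

Set Implicit Arguments.
Unset Strict Implicit.
Unset Printing Implicit Defensive.

Import Order.TTheory GRing.Theory Num.Theory.
Import numFieldNormedType.Exports.

Local Open Scope classical_set_scope.
Local Open Scope ring_scope.

(* Functions on [0, +oo[ are represented by functions R -> R. No definition
   below depends on the values taken at negative arguments. *)

Definition L1loc (R : realType) (f : R -> R) : Prop :=
  forall T : R, 0 < T ->
    (@lebesgue_measure R).-integrable `[0, T] (EFin \o f).

Definition eq_ae (R : realType) (u v : R -> R) : Prop :=
  {ae @lebesgue_measure R, forall t : R, 0 < t -> u t = v t}.

(* [Rintegral] is total; for f, g in L1loc the integrand is integrable for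
   almost every t > 0, so the convolution of two L1loc functions is meaningful
   only up to [eq_ae]. *)
Definition convolution (R : realType) (f g : R -> R) (t : R) : R :=
  \int[@lebesgue_measure R]_(s in `[0, t]) (f s * g (t - s)).

Definition Sonine (R : realType) (g : R -> R) : Prop :=
  L1loc g /\ exists f : R -> R, L1loc f /\ eq_ae (convolution g f) (fun=> 1).

(* Absolute continuity on [a, b]; [l i, r i] are finitely many subintervals of
   [a, b] with pairwise disjoint interiors. *)
Definition abs_cont (R : realType) (a b : R) (F : R -> R) : Prop :=
  forall e : R, 0 < e -> exists2 d : R, 0 < d &
    forall (n : nat) (l r : 'I_n -> R),
      (forall i, a <= l i /\ l i <= r i /\ r i <= b) ->
      trivIset setT (fun i => [set` `]l i, r i[]) ->
      \sum_(i < n) (r i - l i) < d ->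
      \sum_(i < n) `|F (r i) - F (l i)| < e.

Definition ACloc (R : realType) (F : R -> R) : Prop :=
  forall T : R, 0 < T -> abs_cont 0 T F.

(* "du/dt is defined and equals v": u is an a.e. class, so it is differentiated
   through its locally absolutely continuous representative h, which is unique
   on [0, +oo[ by continuity. *)
Definition is_ddt (R : realType) (u v : R -> R) : Prop :=
  exists h : R -> R,
    [/\ ACloc h, eq_ae u h, L1loc v &
        {ae @lebesgue_measure R, forall t : R, 0 < t -> is_derive t 1 h (v t)}].

(* D_g is a partial operator: [is_D g phi psi] means that D_g phi is defined
   and equals psi almost everywhere. *)
Definition is_D (R : realType) (g phi psi : R -> R) : Prop :=
  is_ddt (convolution g phi) psi.

Definition I_ (R : realType) (f phi : R -> R) : R -> R := convolution f phi.

Definition gen_frac_pair (R : realType) (g f : R -> R) : Prop :=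
  [/\ L1loc g, L1loc f,
      forall phi : R -> R, L1loc phi -> is_D g (I_ f phi) phi &
      forall phi : R -> R, ACloc phi ->
        exists2 psi : R -> R, is_D g phi psi & eq_ae (I_ f psi) phi].

Definition gen_frac_derivative (R : realType) (g : R -> R) : Prop :=
  exists f : R -> R, gen_frac_pair g f.

Definition bounded_ae_right0 (R : realType) (g : R -> R) (eps : R) : Prop :=
  exists M : R, {ae @lebesgue_measure R, forall t : R,
    t \in `]0, eps] -> `|g t| <= M}.

(* Main.v *)
(* If |g| <= M near 0, then |(g * f)(t)| <= M int_0^t |f|, which tends to 0 with
   t, so g * f cannot equal 1 almost everywhere. For a generalized fractional
   derivative, apply I_f D_g = id to the constant function 1: psi := D_g 1 is
   the derivative of a representative of t |-> int_0^t g, which is M-Lipschitz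
   near 0; hence |psi| <= M near 0, while psi * f = f * psi = 1. *)
Require Import Defs.
From mathcomp Require Import all_boot all_order all_algebra.
From mathcomp Require Import all_classical all_reals all_analysis.
From mathcomp Require Import measurable_realfun lra.

Set Implicit Arguments.
Unset Strict Implicit.
Unset Printing Implicit Defensive.

Import Order.TTheory GRing.Theory Num.Theory.
Import numFieldNormedType.Exports.

Local Open Scope classical_set_scope.
Local Open Scope ring_scope.

(** Allows [filterS] and [filterS2] to act on statements [{ae mu, ...}]. *)
#[local] Instance lebesgue_ae_filter (R : realType) :
  Filter (nbhs (almost_everywhere (@lebesgue_measure R))) :=
  ae_filter_ringOfSetsType _.

(** * Invariance of Lebesgue integrals under the reflection of [[0, t]] *)

Section reflection.
Context {R : realType}.
Notation mu := (@lebesgue_measure R).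

(** The codomain is typed [measurableTypeR R], which carries the sigma-algebra of [mu], so that [mu]
    can be pushed forward along the map. *)
Definition reflect_at (t : R) : R -> measurableTypeR R := fun s => t - s.

Lemma measurable_reflect_at (t : R) :
  measurable_fun [set: measurableTypeR R] (reflect_at t).
Proof. by apply: measurable_funB. Qed.

Lemma preimage_reflect_at (t : R) : reflect_at t @^-1` `[0, t] = `[0, t]%classic.
Proof.
by apply/seteqP; split=> s; rewrite /= /reflect_at !in_itv/= subr_ge0 gerBl andbC.
Qed.

(** By uniqueness of Lebesgue measure it suffices to look at the intervals []a, b]], whose preimages
    [[t - b, t - a[] have the same length. *)
Lemma lebesgue_measure_reflect_at (t : R) (A : set R) : measurable A ->
  pushforward mu (reflect_at t) A = mu A.
Proof.
move=> mA; apply/esym/lebesgue_measure_unique => //=.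
  exact: measurable_reflect_at.
move=> mr _ [[a b]] _ <-; rewrite /pushforward.
have -> : reflect_at t @^-1` [set` `]a, b]] = `[t - b, t - a[%classic.
  by apply/seteqP; split=> s; rewrite /= /reflect_at !in_itv/= => /andP[? ?]; lra.
rewrite !lebesgue_measure_itv/= !lte_fin ltrD2l ltrN2; case: ifP => // _.
by rewrite -!EFinD; congr (_%:E); lra.
Qed.

Lemma ge0_integral_reflect (t : R) (f : R -> \bar R) :
  measurable_fun `[0, t] f -> (forall s, (0 <= f s)%E) ->
  (\int[mu]_(s in `[0%R, t]) f (t - s)%R = \int[mu]_(s in `[0%R, t]) f s)%E.
Proof.
move=> mf f0; have mr := measurable_reflect_at t.
transitivity (\int[pushforward mu (reflect_at t)]_(s in `[0%R, t]) f s)%E.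
  by rewrite ge0_integral_pushforward// preimage_reflect_at.
by apply: eq_measure_integral => A mA _; exact: lebesgue_measure_reflect_at.
Qed.

(** Positive and negative parts are reflected separately; the identity is one of extended reals. *)
Lemma integral_reflect (t : R) (f : R -> \bar R) : measurable_fun `[0, t] f ->
  (\int[mu]_(s in `[0%R, t]) f (t - s)%R = \int[mu]_(s in `[0%R, t]) f s)%E.
Proof.
move=> mf; rewrite integralE [RHS]integralE.
under eq_integral do rewrite (funepos_comp f (fun s => t - s)%R)/=.
under [X in (_ - X)%E]eq_integral do
  rewrite (funeneg_comp f (fun s => t - s)%R)/=.
congr (_ - _)%E.
  by apply: ge0_integral_reflect => //; exact: measurable_funepos.
by apply: ge0_integral_reflect => //; exact: measurable_funeneg.
Qed.

Lemma measurable_fun_reflect (t : R) (f : R -> R) :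
  measurable_fun `[0, t] f -> measurable_fun `[0, t] (fun s => f (t - s)).
Proof.
move=> mf; apply: (@measurable_comp _ _ _ _ _ _ `[0, t] f _ (reflect_at t)) => //.
  move=> _ [s st <-].
  by rewrite -[_ _]/((reflect_at t @^-1` `[0, t]) s) preimage_reflect_at.
exact: measurable_funTS (measurable_reflect_at t).
Qed.

End reflection.

(** Otherwise []a, b[] would be negligible, although its measure is [b - a > 0]. *)
Lemma ae_exists_itv {R : realType} (P : R -> Prop) (a b : R) : a < b ->
  {ae @lebesgue_measure R, forall t, P t} -> exists2 t, a < t < b & P t.
Proof.
move=> ab aeP; apply: contrapT => /forall2NP nP.
have : @lebesgue_measure R `]a, b[ = 0%E.
  apply: measure_negligible => //; apply: negligibleS aeP => t /=.
  by rewrite in_itv/= => tab Pt; have [] := nP t.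
rewrite lebesgue_measure_itv/= lte_fin ab -EFinB => -[] /eqP.
by rewrite subr_eq0 gt_eqF.
Qed.

(** * Convolution with a kernel bounded near 0 *)

Section convolution_bound.
Context {R : realType}.
Notation mu := (@lebesgue_measure R).
Implicit Types (f g : R -> R) (t eps M : R).

Lemma L1loc_measurable f t : L1loc f -> 0 < t -> measurable_fun `[0, t] f.
Proof.
by move=> Lf t0; apply/measurable_EFinP; exact: measurable_int (Lf t t0).
Qed.

(** The equality is pointwise: both sides are [fine] of the same extended real, whether or not the
    integrand is integrable at this [t]. *)
Lemma convolutionC f g t : L1loc f -> L1loc g -> 0 < t ->
  convolution f g t = convolution g f t.
Proof.
move=> Lf Lg t0; congr fine.
rewrite -[RHS]integral_reflect.
  by apply: eq_integral => s _; rewrite /= subKr mulrC.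
apply/measurable_EFinP/measurable_funM; first exact: L1loc_measurable.
by apply: measurable_fun_reflect; exact: L1loc_measurable.
Qed.

Lemma le_convolution f g t eps M : L1loc f -> L1loc g -> 0 < t -> t <= eps ->
  {ae mu, forall s, s \in `]0, eps] -> `|g s| <= M} ->
  `|convolution g f t| <= M * \int[mu]_(s in `[0, t]) `|f s|.
Proof.
move=> Lf Lg t0 teps gM.
have mf := L1loc_measurable Lf t0.
have mg := L1loc_measurable Lg t0.
have mft := measurable_fun_reflect mf.
(* [M] dominates some value [|g s|], since the bound holds at some point of []0, t[]. *)
have M0 : 0 <= M.
  have [s /andP[s0 st] /(_ _)gsM] := ae_exists_itv (lt_le_trans t0 teps) gM.
  by apply: le_trans (gsM _) => //; rewrite in_itv/= s0 ltW.
have intf : mu.-integrable `[0, t] (EFin \o (Num.norm \o f)).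
  exact: integrable_norm (Lf t t0).
rewrite -lee_fin EFinM fineK; last exact: integrable_fin_num intf.
(* An infinite integral is sent to 0 by [fine], so passing to extended reals can only increase the
   absolute value. *)
apply: (@le_trans _ _ `|\int[mu]_(s in `[0%R, t]) (g s * f (t - s))%:E|%E).
  rewrite /convolution /Rintegral.
  by case: (integral _ _ _) => [r||]; rewrite /= ?normr0 ?leey.
apply: (le_trans (le_abse_integral _ _ _)) => //.
  exact/measurable_EFinP/measurable_funM.
have mnf : measurable_fun `[0, t] (fun s => `|f s|%:E).
  exact/measurable_EFinP/measurableT_comp.
have mnft : measurable_fun `[0, t] (fun s => `|f (t - s)|%:E).
  exact/measurable_EFinP/measurableT_comp.
(* Reflecting the right-hand side makes the integrands comparable pointwise: [|g s * f (t - s)|]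
   against [M * |f (t - s)|]. *)
rewrite -(ge0_integral_reflect mnf)// -ge0_integralZl//.
apply: ae_ge0_le_integral => //.
- exact/measurable_EFinP/measurableT_comp/measurable_funM.
- by move=> s _; rewrite -EFinM lee_fin mulr_ge0.
- by apply: emeasurable_funM.
(* The integral includes the point 0, where nothing is known about [g]. *)
have : {ae mu, forall s, s != 0}.
  exists [set 0]; split => //; first exact: lebesgue_measure_set1.
  by move=> s /= /negP/negPn/eqP.
apply: filterS2 gM => s gM s0 /=; rewrite in_itv/= => /andP[s_ge0 st].
rewrite -EFinM lee_fin normrM ler_wpM2r// gM// in_itv/= lt_neqAle eq_sym s0.
rewrite s_ge0.
exact: le_trans teps.
Qed.

Lemma bounded_convolution_neq1 f g eps : L1loc f -> L1loc g -> 0 < eps ->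
  bounded_ae_right0 g eps -> ~ eq_ae (convolution g f) (fun=> 1).
Proof.
move=> Lf Lg eps0 [M gM] gf1.
have intf : mu.-integrable `[0, eps] (EFin \o (Num.norm \o f)).
  exact: integrable_norm (Lf eps eps0).
(* The integral of [|f|] over [[0, t]] vanishes as [t] tends to 0; [d] is then a radius within which
   the bound stays below 1. *)
have : M * parameterized_integral mu 0 t (Num.norm \o f) @[t --> 0] --> M * 0.
  by apply: cvgMr; exact: parameterized_integral_cvg_left eps0 intf.
rewrite mulr0 => /cvgr0_norm_lt/(_ 1 ltr01) [d /= d0 dP].
pose e := Num.min (d / 2) eps.
have e0 : 0 < e by rewrite lt_min eps0 divr_gt0.
have [t /andP[t0 te] /(_ t0) gft1] := ae_exists_itv e0 gf1.
have teps : t <= eps by rewrite (le_trans (ltW te))// ge_min lexx orbT.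
have td : t < d.
  rewrite (lt_trans te)// gt_min; apply/orP; left.
  by rewrite ltr_pdivrMr// ltr_pMr// ltr1n.
have := le_convolution Lf Lg t0 teps gM.
rewrite gft1 normr1; apply/negP; rewrite -ltNge.
apply: le_lt_trans (ler_norm _) _.
by apply: dP; rewrite /= sub0r normrN gtr0_norm.
Qed.

End convolution_bound.

(** * Boundedness of [D_g 1] near 0, and the two conclusions *)

Section generalized_fractional_derivative.
Context {R : realType}.
Notation mu := (@lebesgue_measure R).
Implicit Types (f g h : R -> R) (a b eps M s t : R).

Lemma is_derive_ae_lipschitz (H h : R -> R) a b M :
  (forall s t, a < s -> s <= t -> t < b -> `|H t - H s| <= M * (t - s)) ->
  {ae mu, forall t, a < t -> H t = h t} ->
  {ae mu, forall t, a < t -> t < b ->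
    forall d, is_derive t 1 h d -> `|d| <= M}.
Proof.
(* Almost every t satisfies H t = h t, and the difference quotients of h at t
   can be taken along points u with H u = h u. *)
move=> lipH aeHh; apply: filterS (aeHh) => t /[swap] at_ /(_ at_) Hht tb d.
move=> [dh dhE].
rewrite leNgt; apply/negP => Md.
have : s^-1 *: (h (s *: 1 + t) - h t) @[s --> 0^'] --> d.
  by rewrite -dhE; exact: dh.
move=> /cvgr_norm_gt/(_ _ Md)[e /= e0 eP].
(* [u] lies within [e] of [t], where the quotient of [h] exceeds [M], and below [b], where the
   Lipschitz bound on [H] contradicts this. *)
have te : t < Num.min (t + e) b by rewrite lt_min tb ltrDl e0.
have [u /andP[tu]] := ae_exists_itv te aeHh.
rewrite lt_min => /andP[ute ub] /(_ (lt_trans at_ tu)) Hhu.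
have ut0 : 0 < u - t by rewrite subr_gt0.
have := eP (u - t); rewrite /= sub0r normrN gtr0_norm// ltrBlDl ute gt_eqF//.
move=> /(_ isT isT); rewrite -[_ *: 1]/(_ * 1) mulr1 subrK -Hht -Hhu.
rewrite normrZ normfV gtr0_norm// ltr_pdivlMl// mulrC.
by rewrite ltNge lipH// ltW.
Qed.

Lemma abs_cont_cst a b (c : R) : abs_cont a b (fun=> c).
Proof.
move=> e e0; exists 1 => // n l r _ _ _.
by rewrite big1// => i _; rewrite subrr normr0.
Qed.

(** Convolving [g] with 1 gives its primitive, whose increment is the integral of [g] over []s,
    t]]. *)
Lemma convolution1_lipschitz g eps M s t : L1loc g ->
  {ae mu, forall u, u \in `]0, eps] -> `|g u| <= M} ->
  0 < s -> s <= t -> t < eps ->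
  `|convolution g (fun=> 1) t - convolution g (fun=> 1) s| <= M * (t - s).
Proof.
move=> Lg gM s0 st teps.
have t0 : 0 < t by exact: lt_le_trans st.
have ig : mu.-integrable `]s, t] (EFin \o g).
  apply: integrableS (Lg t t0) => //.
  by apply: subset_itvr; rewrite bnd_simp ltW.
rewrite /convolution; under eq_Rintegral do rewrite mulr1.
under [X in _ - X]eq_Rintegral do rewrite mulr1.
rewrite Rintegral_itvB ?bnd_simp//; last 2 first.
- exact: Lg.
- exact: ltW.
apply: (le_trans (le_normr_Rintegral _ ig)) => //.
rewrite -lee_fin fineK; last first.
  by apply: integrable_fin_num => //; exact: integrable_norm ig.
have -> : (M * (t - s))%:E = (\int[mu]_(u in `]s, t]) (cst M%:E) u)%E.
  rewrite integral_cst//= lebesgue_measure_itv/= lte_fin.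
  (* The interval measure formula tests [s < t], so [s = t] is treated apart. *)
  move: st; rewrite le_eqVlt => /predU1P[->|->//].
  by rewrite ltxx subrr mulr0 mule0.
have M0 : 0 <= M.
  have [u /andP[u0 ue] /(_ _)guM] := ae_exists_itv (lt_trans t0 teps) gM.
  by apply: le_trans (guM _) => //; rewrite in_itv/= u0 ltW.
apply: ae_ge0_le_integral => //.
- apply/measurable_EFinP/measurableT_comp => //.
  by apply/measurable_EFinP; exact: measurable_int ig.
- apply: filterS gM => u guM /=; rewrite in_itv/= => /andP[su ut].
  rewrite lee_fin guM// in_itv/= (lt_trans s0 su).
  exact: le_trans ut (ltW teps).
Qed.

(** The Lipschitz estimate bounds [psi] for [t < eps] only, while [bounded_ae_right0] includes the
    right endpoint; hence [eps / 2]. *)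
Lemma is_D1_bounded g psi eps : L1loc g -> 0 < eps ->
  bounded_ae_right0 g eps -> is_D g (fun=> 1) psi ->
  bounded_ae_right0 psi (eps / 2).
Proof.
move=> Lg eps0 [M gM] [h [_ gh _ hpsi]]; exists M.
have lip s t := convolution1_lipschitz Lg gM (s := s) (t := t).
apply: filterS2 (is_derive_ae_lipschitz lip gh) hpsi => t tM hpsi.
rewrite in_itv/= => /andP[t0 te]; apply: tM (hpsi t0) => //.
by rewrite (le_lt_trans te)// ltr_pdivrMr// ltr_pMr// ltr1n.
Qed.

Lemma Sonine_unbounded g eps : Sonine g -> 0 < eps -> ~ bounded_ae_right0 g eps.
Proof.
move=> [Lg [f [Lf gf1]]] eps0 bg.
exact: (bounded_convolution_neq1 Lf Lg eps0 bg).
Qed.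

Lemma gen_frac_derivative_unbounded g eps : gen_frac_derivative g -> 0 < eps ->
  ~ bounded_ae_right0 g eps.
Proof.
move=> [f [Lg Lf _ IDg]] eps0 bg.
have [psi D1 fpsi1] := IDg (fun=> 1) (fun _ _ => abs_cont_cst _ _ _).
have Lpsi : L1loc psi by case: (D1) => h [].
have bpsi := is_D1_bounded Lg eps0 bg D1.
have eps20 : 0 < eps / 2 by rewrite divr_gt0.
(* Here [psi] is the bounded kernel, so its convolution with [f] has to be commuted. *)
apply: (bounded_convolution_neq1 Lf Lpsi eps20 bpsi).
by apply: filterS fpsi1 => t + t0; rewrite /I_ convolutionC// => ->.
Qed.

End generalized_fractional_derivative.

Theorem mainTheorem2 (R : realType) (g : R -> R) :
  (Sonine g -> forall eps : R, 0 < eps -> ~ bounded_ae_right0 g eps) /\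
  (gen_frac_derivative g ->
     forall eps : R, 0 < eps -> ~ bounded_ae_right0 g eps).
Proof.
split=> [Sg|Dg] eps eps0; first exact: Sonine_unbounded.
exact: gen_frac_derivative_unbounded.
Qed.
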